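(* Let $X$ be a separable, metrizable, complete topological semigroup with identity $e$, and for each $n\in\mathbb{N}$ let $T_{1,n}$ and $T_{2,n}$ be continuous homomorphisms on $X$ (i.e. from $X$ to $X$). Suppose there are dense subsets $D_0,D_1,D_2$ of $X$, a subsequence $(n_k)$ of $\mathbb{N}$, and maps $S_{1,n_k}:D_1\to X$ and $S_{2,n_k}:D_2\to X$ ($k\in\mathbb{N}$) such that for all $i,j\in\{1,2\}$: (1) $\lim_{k\to\infty}T_{i,n_k}x=e$ for every $x\in D_0$; (2) $\lim_{k\to\infty}S_{i,n_k}x=e$ for every $x\in D_i$; (3) for every $x\in D_j$, $\lim_{k\to\infty}T_{i,n_k}S_{j,n_k}x=x$ if $i=j$, and $\lim_{k\to\infty}T_{i,n_k}S_{j,n_k}x=e$ if $i\neq j$. Then the set of disjointly universal vectors for $(T_{1,n})_n,(T_{2,n})_n$ is a dense $G_\delta$ subset of $X$. Furthermore, there exists a disjointly universal vector for $(T_{1,n})_n,(T_{2,n})_n$ of the form $\prod_{i=1}^{\infty}x_i$ with $x_i\in D_0$ for all $i$.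
   Context: ''Metrizable, complete'' means that the topology of $X$ is induced by a complete metric. A topological semigroup is a semigroup with a topology for which multiplication $X\times X\to X$ is continuous; a homomorphism $T$ on $X$ is a map $T:X\to X$ with $T(xy)=T(x)T(y)$ for all $x,y\in X$. The maps $S_{i,n_k}$ are not assumed to be continuous or multiplicative. A disjointly universal vector (element) for two sequences $(T_{1,n})_n,(T_{2,n})_n$ of continuous self-maps of a topological space $X$ is a point $x\in X$ such that $\{(T_{1,n}(x),T_{2,n}(x)):n\in\mathbb{N}\}$ is dense in $X\times X$ with the product topology. The infinite product $\prod_{i=1}^{\infty}x_i$ denotes the limit in $X$ of the finite products $\prod_{i=1}^{k}x_i$ as $k\to\infty$. *)

(* Defs.v *)
From HB Require Import structures.
From mathcomp Require Export all_boot all_order all_algebra.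
From mathcomp Require Export all_classical all_reals all_analysis borel_hierarchy.

#[export] Set Implicit Arguments.
#[export] Unset Strict Implicit.
#[export] Unset Printing Implicit Defensive.

Import Order.TTheory GRing.Theory Num.Theory.
Local Open Scope classical_set_scope.
Local Open Scope ring_scope.

#[short(type="preTopologicalMonoidType")]
HB.structure Definition PreTopologicalMonoid :=
  {X of Topological X & Monoid X}.

HB.mixin Record PreTopologicalMonoid_isTopologicalMonoid X
    of PreTopologicalMonoid X := {
  mulg_continuous : continuous (fun xy : X * X => (xy.1 * xy.2)%g)
}.

(* Topological semigroups with identity; the identity is (1 : X)%g. *)
#[short(type="topologicalMonoidType")]
HB.structure Definition TopologicalMonoid :=
  {X of PreTopologicalMonoid X & PreTopologicalMonoid_isTopologicalMonoid X}.

Definition is_metric (R : realType) (X : Type) (d : X -> X -> R) : Prop :=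
  [/\ forall x y, 0 <= d x y,
      forall x y, d x y = 0 <-> x = y,
      forall x y, d x y = d y x &
      forall x y z, d x z <= d x y + d y z].

Definition induces_topology (R : realType) (X : topologicalType)
    (d : X -> X -> R) : Prop :=
  forall (x : X) (U : set X),
    nbhs x U <-> exists2 r : R, 0 < r & [set y | d x y < r] `<=` U.

(* Convergence refers to the topology of X, which is the one induced by d
   wherever this definition is used. *)
Definition complete_metric (R : realType) (X : topologicalType)
    (d : X -> X -> R) : Prop :=
  forall u : nat -> X,
    (forall r : R, 0 < r ->
       exists N, forall m n, (N <= m)%N -> (N <= n)%N -> d (u m) (u n) < r) ->
    exists l : X, u @ \oo --> l.

Definition completely_metrizable (R : realType) (X : topologicalType) : Prop :=
  exists d : X -> X -> R,
    [/\ is_metric d, induces_topology d & complete_metric d].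

Definition separable_space (X : topologicalType) : Prop :=
  exists2 A : set X, countable A & dense A.

Definition disjointly_universal (X : topologicalType) (T1 T2 : nat -> X -> X) :
    set X :=
  [set x | dense (range (fun n => (T1 n x, T2 n x)))].

Definition is_infinite_product (X : topologicalMonoidType) (u : nat -> X)
    (x : X) : Prop :=
  (\prod_(0 <= i < k) u i)%g @[k --> \oo] --> x.

(* Main.v *)
Require Import Defs.

(** Call p vanishing when T_{i,n_k} p tends to e for both i. Elements of D_0
    vanish, and so do their finite products, since each T_{i,n} is
    multiplicative. The key observation is that a vanishing p extends to a
    better product: if V is a nonempty open subset of X x X, pick
    (y_1, y_2) in V with y_i in D_i and put z_k = S_{1,n_k} y_1 * S_{2,n_k} y_2.
    Then p z_k tends to p, whereas
      T_{1,n_k} (p z_k) -> e * (y_1 * e) = y_1,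
      T_{2,n_k} (p z_k) -> e * (e * y_2) = y_2.
    So for a large k the product p z_k is as close to p as desired and has its
    pair of images in V. Both conditions are open in z_k, and D_0 is dense, so
    z_k may be replaced by an element x of D_0 ([extend_by_D0]).

    Universality means meeting each member W_m of a countable pi-base of X x X
    ([universal_bigcap]), and the set of points some pair of images of which
    lies in W_m is open; this gives the G_delta property. For the rest, start
    from any element of D_0 in a given nonempty open set O and multiply it on
    the right, one factor of D_0 after the other, so that the m-th partial
    product lies in the open set attached to W_m, together with a ball around
    it in which all later partial products stay. By completeness the partial
    products converge, and the limit lies in O and is universal
    ([chain_into_open_sets], [universal_infinite_product]). Since O is
    arbitrary, this yields at once the density of the universal points and a
    universal infinite product, without a separate appeal to Baire's theorem.

    The induction starts from a factor in D_0 and not from the empty product: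
    T_{i,n} is a semigroup homomorphism, so that T_{i,n} e is merely an
    idempotent and e itself might not vanish. *)

Import Order.TTheory GRing.Theory Num.Theory.

Local Open Scope classical_set_scope.

(** * Countable pi-bases *)

(** A pi-base tests density as well as a base does, and for a product it is
    enough to take boxes. *)
Definition pi_base (Y : topologicalType) (W : nat -> set Y) : Prop :=
  [/\ forall m, open (W m), forall m, W m !=set0 &
      forall O, open O -> O !=set0 -> exists m, W m `<=` O].

Lemma pi_base_denseP (Y : topologicalType) (W : nat -> set Y) (A : set Y) :
  pi_base W -> dense A <-> forall m, W m `&` A !=set0.
Proof.
move=> [Wo Wn0 Wsub]; split=> [dA m|WA O On0 Oo]; first exact: dA.
have [m WO] := Wsub O Oo On0.
by have [y [/WO Oy Ay]] := WA m; exists y.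
Qed.

Lemma nbhs_prod_box (Y Z : topologicalType) (O : set (Y * Z)) (y : Y) (z : Z) :
  open O -> O (y, z) ->
  exists A : set Y, exists B : set Z,
    [/\ open A, open B, A y, B z & A `*` B `<=` O].
Proof.
rewrite openE => Oo Oyz; have [[A B] /= [yA zB] ABO] := Oo _ Oyz.
exists A^°, B^°; split; [exact: open_interior|exact: open_interior| | |].
- exact: yA.
- exact: zB.
- by move=> [a b] [/= Aa Bb]; apply: ABO; split=> /=; exact: interior_subset.
Qed.

Lemma open_setX (Y Z : topologicalType) (A : set Y) (B : set Z) :
  open A -> open B -> open (A `*` B).
Proof.
move=> Ao Bo; rewrite openE => -[y z] [/= Ay Bz].
by exists (A, B) => //; split; exact: open_nbhs_nbhs.
Qed.

Lemma dense_setX (Y Z : topologicalType) (A : set Y) (B : set Z) :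
  dense A -> dense B -> dense (A `*` B).
Proof.
move=> dA dB O [[y z] Oyz] Oo.
have [G [H [Go Ho Gy Hz GHO]]] := nbhs_prod_box Oo Oyz.
have [a [Ga Aa]] := dA G (ex_intro _ y Gy) Go.
have [b [Hb Bb]] := dB H (ex_intro _ z Hz) Ho.
by exists (a, b); split=> //; exact: GHO.
Qed.

(** The default value only makes this a surjection from nat onto the pairs;
    repeated members are harmless in a pi-base. *)
Definition unpair (m : nat) : nat * nat := odflt (0, 0)%N (unpickle m).

Lemma unpair_pickle (ab : nat * nat) : unpair (pickle ab) = ab.
Proof. by rewrite /unpair pickleK. Qed.

Lemma pi_base_setX (Y Z : topologicalType) (V : nat -> set Y)
    (W : nat -> set Z) :
  pi_base V -> pi_base W ->
  pi_base (fun m => V (unpair m).1 `*` W (unpair m).2).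
Proof.
move=> [Vo Vn0 Vsub] [Wo Wn0 Wsub]; split.
- by move=> m; exact: open_setX.
- move=> m; have [y Vy] := Vn0 (unpair m).1; have [z Wz] := Wn0 (unpair m).2.
  by exists (y, z).
- move=> O Oo [[y z] Oyz].
  have [G [H [Go Ho Gy Hz GHO]]] := nbhs_prod_box Oo Oyz.
  have [a VG] := Vsub G Go (ex_intro _ y Gy).
  have [b WH] := Wsub H Ho (ex_intro _ z Hz).
  exists (pickle (a, b)); rewrite unpair_pickle => -[v w] [/= Vv Ww].
  by apply: GHO; split=> /=; [exact: VG|exact: WH].
Qed.

Section MetricTopology.
Local Open Scope ring_scope.
Variables (R : realType) (X : topologicalType) (d : X -> X -> R).
Hypotheses (d_metric : is_metric d) (d_top : induces_topology d).

Let d_refl x : d x x = 0.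
Proof. by case: d_metric => _ d0 _ _; exact/d0. Qed.

Let d_sym x y : d x y = d y x.
Proof. by case: d_metric. Qed.

Let d_tri x y z : d x z <= d x y + d y z.
Proof. by case: d_metric. Qed.

Lemma metric_ball_nbhs (x : X) (r : R) : 0 < r -> nbhs x [set y | d x y < r].
Proof. by move=> r0; apply/d_top; exists r. Qed.

Lemma metric_ball_open (x : X) (r : R) : open [set y | d x y < r].
Proof.
rewrite openE => y /= xy; apply/d_top; exists (r - d x y).
  by rewrite subr_gt0.
by move=> z /= yz; rewrite (le_lt_trans (d_tri x y z))// -ltrBrDl.
Qed.

Lemma open_metric_ball (O : set X) (x : X) :
  open O -> O x -> exists2 r, 0 < r & [set y | d x y < r] `<=` O.
Proof. by move=> Oo Ox; apply/d_top; exact: open_nbhs_nbhs. Qed.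

Lemma pi_base_separable_metric (f : nat -> X) :
  dense (range f) ->
  pi_base (fun m => [set y | d (f (unpair m).1) y < (unpair m).2.+1%:R^-1]).
Proof.
move=> df; split.
- by move=> m; exact: metric_ball_open.
- by move=> m; exists (f (unpair m).1); rewrite /= d_refl invr_gt0 ltr0n.
- move=> O Oo [x Ox]; have [r r0 rO] := open_metric_ball Oo Ox.
  have r20 : 0 < r / 2 by rewrite divr_gt0.
  have [q _ /(_ q (leqnn q)) /= qr] := near_infty_natSinv_lt (PosNum r20).
  have q0 : 0 < (q.+1%:R^-1 : R) by rewrite invr_gt0 ltr0n.
  have [b [/= xb [a _ ab]]] : [set y | d x y < q.+1%:R^-1] `&` range f !=set0.
    by apply: df; [exists x; rewrite /= d_refl|exact: metric_ball_open].
  exists (pickle (a, q)); rewrite unpair_pickle /= => y /= ay.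
  apply: rO => /=; rewrite (le_lt_trans (d_tri x (f a) y))// (splitr r).
  by rewrite ab in ay *; rewrite ltrD// (lt_trans _ qr).
Qed.

(** * Baire's argument along a relation *)

Hypothesis d_complete : complete_metric d.

(** Baire's argument with constrained centres: the centres of the nested balls
    are not arbitrary but form a chain for [step] inside [A], which is what
    makes the limit an infinite product later on. The state of the construction
    is (index, centre, radius); ball k+1 has twice its radius inside [E k], as
    the limit is only known to lie in each doubled ball. *)
Lemma chain_into_open_sets (A : set X) (step : X -> X -> Prop)
    (E : nat -> set X) :
  (forall m, open (E m)) ->
  (forall m p O, A p -> open O -> O p ->
     exists q, [/\ A q, step p q, O q & E m q]) ->
  forall p0 O, A p0 -> open O -> O p0 ->
  exists p : nat -> X,
    [/\ p 0%N = p0, forall k, step (p k) (p k.+1) &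
        exists2 l, p @ \oo --> l & O l /\ forall m, E m l].
Proof.
move=> Eo Astep p0 O Ap0 Oo Op0.
pose good (s : nat * X * R) := A s.1.2 /\ 0 < s.2.
pose next (s t : nat * X * R) :=
  [/\ good t, t.1.1 = s.1.1.+1, step s.1.2 t.1.2,
     [/\ t.2 <= s.2 / 2, t.2 <= s.1.1.+1%:R^-1 & d s.1.2 t.1.2 < s.2 / 2]
   & [set y | d t.1.2 y < 2 * t.2] `<=` E s.1.1].
have nextP s : {t | good s -> next s t}.
  apply: cid; case: (pselect (good s)) => [[]|ngs]; last by exists s.
  case: s => -[m p] r /= Ap r0.
  have r20 : 0 < r / 2 by rewrite divr_gt0.
  (* Moving by less than r/2 and at least halving the radius nests the balls. *)
  have [||q [Aq pq dpq Emq]] := Astep m p [set y | d p y < r / 2] Ap.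
  - exact: metric_ball_open.
  - by rewrite /= d_refl.
  - have [e e0 eE] := open_metric_ball (Eo m) Emq.
    pose r' := Num.min (e / 2) (Num.min (r / 2) m.+1%:R^-1).
    exists (m.+1, q, r') => _; rewrite /next /good /=; split=> //.
    + by split=> //; rewrite /r' !lt_min r20 invr_gt0 ltr0n divr_gt0.
    + by split=> //; rewrite /r' !ge_min lexx !orbT.
    + move=> y /= qy; apply: eE; apply: (lt_le_trans qy).
      by rewrite mulrC -ler_pdivlMr// /r' ge_min lexx.
(* The initial radius is e/2 because the limit may leave the first ball, but
   not the ball of radius e. *)
have [e e0 eO] := open_metric_ball Oo Op0.
have [s [s0 snext]] := dependent_choice nextP (0%N, p0, e / 2).
have sgood k : good (s k).
  elim: k => [|k IH]; first by rewrite s0; split=> //=; rewrite divr_gt0.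
  by case: (snext k IH).
have {}snext k : next (s k) (s k.+1) by exact: snext.
pose p k := (s k).1.2; pose r k := (s k).2.
have sE k : (s k).1.1 = k.
  by elim: k => [|k IH]; [rewrite s0|have [_ -> _ _ _] := snext k; rewrite IH].
have r_gt0 k : 0 < r k by case: (sgood k).
have nested k m y : (k <= m)%N -> d (p m) y < r m -> d (p k) y < r k.
  move=> /subnK <-; elim: (m - k)%N => [//|j IH]; rewrite addSn => pry.
  apply: IH; have [_ _ _ [rr _ dp] _] := snext (j + k)%N.
  rewrite (le_lt_trans (d_tri _ (p (j + k).+1) _))// (splitr (r _)) ltrD//.
  exact: lt_le_trans rr.
have pin k m : (k <= m)%N -> d (p k) (p m) < r k.
  by move=> km; apply: (nested k m) => //; rewrite d_refl.
have [a a0|l pl] := @d_complete p.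
  have a20 : 0 < a / 2 by rewrite divr_gt0.
  have [q _ /(_ q (leqnn q)) /= qa] := near_infty_natSinv_lt (PosNum a20).
  have rqa : r q.+1 < a / 2.
    by have [_ _ _ [_ + _] _] := snext q; rewrite sE => /le_lt_trans; apply.
  exists q.+1 => i j qi qj; rewrite (le_lt_trans (d_tri _ (p q.+1) _))//.
  by rewrite (splitr a) ltrD// ?[d (p i) _]d_sym (lt_trans (pin _ _ _) rqa).
have lin k : d (p k) l < 2 * r k.
  have [N _ Nl] := pl _ (metric_ball_nbhs l (r_gt0 k)).
  rewrite (le_lt_trans (d_tri _ (p (maxn N k)) _))// mulr_natl mulr2n.
  rewrite ltrD ?pin ?leq_maxr// d_sym; exact: (Nl _ (leq_maxl _ _)).
exists p; split; [by rewrite /p s0|by move=> k; case: (snext k)|].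
exists l => //; split.
  by apply: eO; have := lin 0%N; rewrite /p /r s0 /= mulrC divfK.
move=> m; have [_ _ _ _] := snext m; rewrite sE; apply; exact: lin.
Qed.

End MetricTopology.

(** The point of [X] rules out an empty countable dense set, which no sequence
    enumerates. *)
Lemma dense_sequence (X : topologicalType) :
  X -> separable_space X -> exists f : nat -> X, dense (range f).
Proof.
move=> x [A /pfcard_geP[->|[f]] dA].
  by have [y []] := dA setT (ex_intro _ x I) openT.
exists f => O On0 Oo; have [y [Oy Ay]] := dA O On0 Oo.
by exists y; split=> //; have [k _ <-] := @surj _ _ _ _ f y Ay; exists k.
Qed.

Lemma separable_metrizable_pi_base (R : realType) (X : topologicalType) :
  X -> separable_space X -> completely_metrizable R X ->
  exists W : nat -> set X, pi_base W.
Proof.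
move=> x /(dense_sequence x)[f df] [d [dm dt _]].
have Wb := pi_base_separable_metric dm dt df; by eexists; exact: Wb.
Qed.

(** * Universal points *)

Lemma universal_bigcap (X Y : topologicalType) (P : nat -> X -> Y)
    (W : nat -> set Y) :
  pi_base W ->
  [set x | dense (range (P ^~ x))] =
  \bigcap_m \bigcup_k (P k @^-1` W m).
Proof.
move=> Wb; apply/seteqP; split=> x /=.
- move=> /(pi_base_denseP _ Wb) dP m _.
  by have [_ [/[swap] -[k _ <-] Wk]] := dP m; exists k.
- move=> xP; apply/(pi_base_denseP _ Wb) => m.
  by have [k _ Wk] := xP m I; exists (P k x); split=> //; exists k.
Qed.

Lemma open_hitting (X Y : topologicalType) (P : nat -> X -> Y) (V : set Y) :
  (forall k, continuous (P k)) -> open V -> open (\bigcup_k (P k @^-1` V)).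
Proof.
move=> Pc Vo; apply: bigcup_open => k _.
by apply: open_comp => // x _; exact: Pc.
Qed.

Lemma cvg_mulg (X : topologicalMonoidType) (I : Type) (F : set_system I)
    (FF : Filter F) (f g : I -> X) (a b : X) :
  f @ F --> a -> g @ F --> b -> (f x * g x)%g @[x --> F] --> (a * b)%g.
Proof.
apply: (@continuous2_cvg I X X X F FF f g (fun x y => (x * y)%g) a b).
exact: (@mulg_continuous X (a, b)).
Qed.

Lemma cvg_morphM (X : topologicalMonoidType) (I : Type) (F : set_system I)
    (FF : Filter F) (f : I -> {multiplicative X -> X}) (u v : I -> X)
    (a b : X) :
  f k (u k) @[k --> F] --> a -> f k (v k) @[k --> F] --> b ->
  f k (u k * v k)%g @[k --> F] --> (a * b)%g.
Proof.
move=> fu fv; rewrite (_ : (fun k => _) = fun k => (f k (u k) * f k (v k))%g).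
  exact: cvg_mulg.
by apply/funext => k; rewrite gmulfM.
Qed.

(** * Disjoint universality *)

Section DisjointUniversality.
Variables (R : realType) (X : topologicalMonoidType).
Variables (T : 'I_2 -> nat -> {multiplicative X -> X}).
Variables (D0 : set X) (D : 'I_2 -> set X) (n : nat -> nat).
Variables (S : forall i : 'I_2, nat -> D i -> X).
Hypotheses (T_continuous : forall i n, continuous (T i n)).
Hypotheses (D0_dense : dense D0) (D_dense : forall i, dense (D i)).
Hypothesis S_cvg : forall i (x : D i), S k x @[k --> \oo] --> (1 : X)%g.
Hypothesis TS_cvg : forall i j (x : D j),
  T i (n k) (S k x) @[k --> \oo] --> (if i == j then \val x else 1%g).

Definition pairT (k : nat) (x : X) : X * X := (T ord0 k x, T ord_max k x).

(** The empty product need not satisfy this, as [T i k] may fail to preserve the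
    identity. *)
Definition orbit_vanishes (p : X) : Prop :=
  forall i, T i (n k) p @[k --> \oo] --> (1 : X)%g.

Lemma orbit_vanishesM (p q : X) :
  orbit_vanishes p -> orbit_vanishes q -> orbit_vanishes (p * q)%g.
Proof.
by move=> vp vq i; have := cvg_morphM _ (vp i) (vq i); rewrite mulg1; apply.
Qed.

Lemma pairT_continuous k : continuous (pairT k).
Proof. by move=> x; apply: cvg_pair; exact: T_continuous. Qed.

(** The perturbation [S k a * S k b] tends to the identity but is moved by
    [pairT (n k)] to nearly [(a, b)], while [p] itself becomes invisible to
    [pairT (n k)]; continuity then lets an element of [D0] replace it. *)
Lemma extend_by_D0 (p : X) (O : set X) (V : set (X * X)) :
  orbit_vanishes p -> open O -> O p -> open V -> V !=set0 ->
  exists2 x, D0 x & O (p * x)%g /\ exists k, V (pairT k (p * x)%g).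
Proof.
move=> vp Oo Op Vo Vn0.
have [[y0 y1] [Vy [/= Dy0 Dy1]]] :=
  dense_setX (D_dense ord0) (D_dense ord_max) Vn0 Vo.
pose a : D ord0 := SigSub (mem_set Dy0).
pose b : D ord_max := SigSub (mem_set Dy1).
pose z k := (S k a * S k b)%g.
have pz : (p * z k)%g @[k --> \oo] --> p.
  by have := cvg_mulg _ (cvg_cst p) (cvg_mulg _ (S_cvg a) (S_cvg b));
    rewrite !mulg1; apply.
have Tpz : pairT (n k) (p * z k)%g @[k --> \oo] --> (y0, y1).
  have Tz i : T i (n k) (p * z k)%g @[k --> \oo] -->
      (1 * ((if i == ord0 then y0 else 1) * (if i == ord_max then y1 else 1)))%g.
    apply: cvg_morphM; first exact: vp.
    by apply: cvg_morphM; [exact: (@TS_cvg i _ a)|exact: (@TS_cvg i _ b)].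
  apply: cvg_pair.
  - by have := Tz ord0; rewrite /= mul1g mulg1.
  - by have := Tz ord_max; rewrite /= !mul1g.
have [k [Opz Vpz]] : exists k, O (p * z k)%g /\ V (pairT (n k) (p * z k)%g).
  have pzO : \forall k \near \oo, O (p * z k)%g.
    exact: pz _ (open_nbhs_nbhs (conj Oo Op)).
  have TpzV : \forall k \near \oo, V (pairT (n k) (p * z k)%g).
    exact: Tpz _ (open_nbhs_nbhs (conj Vo Vy)).
  by have [k []] := filter_ex (filterI pzO TpzV); exists k.
have mulp_continuous : continuous (fun x : X => (p * x)%g).
  by move=> x; apply: cvg_mulg; [exact: cvg_cst|exact: cvg_id].
pose G := (fun x => (p * x)%g) @^-1` (O `&` pairT (n k) @^-1` V).
have Go : open G.
  apply: open_comp => [x _|]; first exact: mulp_continuous.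
  apply: openI => //; apply: open_comp => // x _; exact: pairT_continuous.
have [x [[Ox Vx] D0x]] := D0_dense (ex_intro _ (z k) (conj Opz Vpz)) Go.
by exists x => //; split=> //; exists (n k).
Qed.

Hypothesis T_cvg : forall i x, D0 x -> T i (n k) x @[k --> \oo] --> (1 : X)%g.
Hypothesis X_complete : completely_metrizable R X.

(** The statement is relative to an open set [O] so that it gives the density of
    the universal points along with the existence of a universal product. *)
Lemma universal_infinite_product (W : nat -> set (X * X)) (O : set X) :
  pi_base W -> open O -> O !=set0 ->
  exists2 u : nat -> X, (forall i, D0 (u i)) &
    exists2 x : X, is_infinite_product u x &
      O x /\ disjointly_universal (T ord0) (T ord_max) x.
Proof.
move=> Wb; have [Wo Wn0 _] := Wb; have [d [dm dt dc]] := X_complete.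
move=> Oo On0; have [u0 [Ou0 D0u0]] := D0_dense On0 Oo.
pose step p q := exists2 x, D0 x & q = (p * x)%g.
have [|m p G vp Go Gp||p [p0 pstep [l pl [Ol El]]]] :=
    @chain_into_open_sets R X d dm dt dc orbit_vanishes step
      (fun m => \bigcup_k (pairT k @^-1` W m)) _ _ u0 O _ Oo Ou0.
- by move=> m; apply: open_hitting => // k; exact: pairT_continuous.
- have [x D0x [Gpx [k Wk]]] := extend_by_D0 vp Go Gp (Wo m) (Wn0 m).
  exists (p * x)%g; split=> //; [|by exists x|by exists k].
  by apply: orbit_vanishesM => // i; exact: T_cvg.
- by move=> i; exact: T_cvg.
have [v vD0 pv] : exists2 v : nat -> X,
    (forall k, D0 (v k)) & forall k, p k.+1 = (p k * v k)%g.
  have [v vP] := choice (fun k => let: ex_intro2 x Dx e := pstep k in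
    ex_intro (fun x => D0 x /\ p k.+1 = (p k * x)%g) x (conj Dx e)).
  by exists v => k; have [] := vP k.
(* The partial product of length k+1 is p k, so the chain starts from the
   one-factor product u0. *)
pose u k := if k is j.+1 then v j else u0.
have pE k : (\prod_(0 <= i < k.+1) u i)%g = p k.
  elim: k => [|k IH]; first by rewrite big_nat1 p0.
  by rewrite big_nat_recr//= IH pv.
exists u; first by case.
exists l.
  move=> G lG; have [N _ pG] := pl G lG.
  by exists N.+1 => // -[//|k] /= Nk; rewrite pE; exact: pG.
split=> //; rewrite /disjointly_universal (universal_bigcap pairT Wb) => m _.
exact: El.
Qed.

End DisjointUniversality.

Theorem theorem2p2 (R : realType) (X : topologicalMonoidType)
    (X_separable : separable_space X)
    (X_complete : completely_metrizable R X)
    (T : 'I_2 -> nat -> {multiplicative X -> X})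
    (T_continuous : forall i n, continuous (T i n))
    (D0 : set X) (D : 'I_2 -> set X)
    (D0_dense : dense D0)
    (D_dense : forall i, dense (D i))
    (n : nat -> nat)
    (n_increasing : {homo n : k l / (k < l)%N})
    (S : forall i : 'I_2, nat -> D i -> X)
    (T_cvg : forall i x, D0 x -> T i (n k) x @[k --> \oo] --> (1 : X)%g)
    (S_cvg : forall i (x : D i), S i k x @[k --> \oo] --> (1 : X)%g)
    (TS_cvg : forall i j (x : D j),
       T i (n k) (S j k x) @[k --> \oo] --> (if i == j then \val x else 1%g)) :
  let U := disjointly_universal (T ord0) (T ord_max) in
  [/\ dense U, Gdelta U &
      exists2 u : nat -> X, (forall i, D0 (u i)) &
        exists2 x : X, is_infinite_product u x & U x].
Proof.
have [V Vb] := separable_metrizable_pi_base (1 : X)%g X_separable X_complete.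
have [W Wb] : exists W : nat -> set (X * X), pi_base W.
  by exists (fun m => V (unpair m).1 `*` V (unpair m).2); exact: pi_base_setX.
have product O : open O -> O !=set0 -> _ :=
  universal_infinite_product T_continuous D0_dense D_dense S_cvg TS_cvg
    T_cvg X_complete Wb.
move=> U; split.
- move=> O On0 Oo; have [_ _ [x _ [Ox Ux]]] := product O Oo On0.
  by exists x.
- exists (fun m => \bigcup_k (pairT T k @^-1` W m)).
    move=> m; apply: open_hitting => [k|]; first exact: pairT_continuous.
    by have [] := Wb.
  exact: (universal_bigcap (pairT T) Wb).
- have [u uD0 [x ux [_ Ux]]] := product setT openT (ex_intro _ (1 : X)%g I).
  by exists u => //; exists x.
Qed.
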